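(* Let $n\geq 2$, let $T_n$ be the twin group with generators $s_1,\ldots,s_{n-1}$, and let $\mathbb{F}_n$ be the free group with free generators $x_1,\ldots,x_n$. Let $\eta_1:T_n\to\mathrm{Aut}(\mathbb{F}_n)$ be the representation for which $\eta_1(s_i)$ is given by $x_i\mapsto x_ix_{i+1}x_i^{-1}$, $x_{i+1}\mapsto x_ix_{i+1}^{-1}x_ix_{i+1}x_i^{-1}$, and $x_k\mapsto x_k$ for $k\notin\{i,i+1\}$. Then the matrix representation of $T_n$ derived from $\eta_1$ (by means of the Magnus representation using Fox derivatives, i.e. sending $s_i$ to the Jacobian matrix $J(s_i)$) is the representation of $T_n$ where the images of the generators are as follows: for $1\leq i\leq n-1$, $$s_i\mapsto\left(\begin{array}{c|c|c} I_{i-1} & 0 & 0\\ \hline 0 & \begin{matrix} 1-x_ix_{i+1}x_i^{-1} & x_i\\ 1+x_ix_{i+1}^{-1}-x_ix_{i+1}^{-1}x_ix_{i+1}x_i^{-1} & -x_ix_{i+1}^{-1}+x_ix_{i+1}^{-1}x_i\end{matrix} & 0\\ \hline 0 & 0 & I_{n-i-1}\end{array}\right).$$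
   Context: The twin group $T_n$ has generators $s_1,\ldots,s_{n-1}$ and relations $s_i^2=1$ ($1\le i\le n-1$) and $s_is_j=s_js_i$ ($|i-j|\geq 2$). For $1\leq k\leq n$, the Fox derivative $D_k=\partial/\partial x_k$ on the group ring $\mathbb{Z}[\mathbb{F}_n]$ is the $\mathbb{Z}$-linear map determined by $D_k(x_i)=\delta_{ik}$, $D_k(x_i^{-1})=-\delta_{ik}x_i^{-1}$, and $D_k(uv)=D_k(u)+u\,D_k(v)$ for $u,v\in\mathbb{F}_n$, where $\delta_{ik}$ is the Kronecker symbol. The Jacobian matrix $J(s_i)$ of the image of $s_i$ is the $n\times n$ matrix whose $(l,k)$ entry is $D_k(\eta_1(s_i)(x_l))$. $I_r$ denotes the $r\times r$ identity matrix.
   Formalization: ''Representation'' is taken in the Magnus (twisted) sense: J(1) = I and J(gh) = η₁(g)(J(h))·J(g), with η₁(g) acting entrywise; as an ordinary homomorphism the claim fails, since J(s_i)² ≠ I over Z[F_n]. *)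

(* Defs.v *)
From HB Require Import structures.
From mathcomp Require Import all_boot all_algebra.
From mathcomp Require Import boolp finmap.
From mathcomp Require Import monalg.
From mathcomp Require Import monoid.

Set Implicit Arguments.
Unset Strict Implicit.
Unset Printing Implicit Defensive.

Import GRing.Theory IntDist.
Local Open Scope quotient_scope.
Local Open Scope ring_scope.

(* The letter (i, true) is the generator i, and (i, false) is its inverse. *)
Definition word (I : Type) := seq (I * bool).

Inductive pres_eq (I : Type) (R : word I -> word I -> Prop) :
    word I -> word I -> Prop :=
| pres_rel u v : R u v -> pres_eq R u v
| pres_cancel i b : pres_eq R [:: (i, b); (i, ~~ b)] [::]
| pres_refl u : pres_eq R u u
| pres_sym u v : pres_eq R u v -> pres_eq R v u
| pres_trans u v w : pres_eq R u v -> pres_eq R v w -> pres_eq R u w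
| pres_cat u u' v v' :
    pres_eq R u u' -> pres_eq R v v' -> pres_eq R (u ++ v) (u' ++ v').

Section Presented.
Context {I : choiceType} (R : word I -> word I -> Prop).

Definition pres_eqb : rel (word I) := fun u v => `[< pres_eq R u v >].

Lemma pres_eqb_refl : reflexive pres_eqb.
Proof. by move=> u; apply/asboolP/pres_refl. Qed.

Lemma pres_eqb_sym : symmetric pres_eqb.
Proof. by move=> u v; apply/asboolP/asboolP; apply: pres_sym. Qed.

Lemma pres_eqb_trans : transitive pres_eqb.
Proof.
by move=> v u w /asboolP uv /asboolP vw; apply/asboolP; apply: pres_trans vw.
Qed.

Canonical pres_equiv :=
  EquivRel pres_eqb pres_eqb_refl pres_eqb_sym pres_eqb_trans.

(* The group with generators I and relations u = v for R u v. *)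
Definition presented : Type := {eq_quot pres_equiv}.
HB.instance Definition _ := Choice.on presented.
HB.instance Definition _ := EqQuotient.on presented.

Definition word_inv (w : word I) : word I := rev [seq (l.1, ~~ l.2) | l <- w].

Definition pres_class (w : word I) : presented := \pi_presented w.
Definition pres_one : presented := pres_class [::].
Definition pres_mul (x y : presented) : presented :=
  pres_class (repr x ++ repr y).
Definition pres_inv (x : presented) : presented :=
  pres_class (word_inv (repr x)).
Definition pres_gen (i : I) : presented := pres_class [:: (i, true)].

Lemma pres_classP u v : pres_class u = pres_class v <-> pres_eq R u v.
Proof.
by split=> [/eqmodP/asboolP|uv]; last exact/eqmodP/asboolP.
Qed.

Lemma pres_reprK x : pres_class (repr x) = x.
Proof. exact: reprK. Qed.

Lemma pres_eq_repr w : pres_eq R (repr (pres_class w)) w.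
Proof. by apply/pres_classP; rewrite pres_reprK. Qed.

Lemma pres_mulE u v : pres_mul (pres_class u) (pres_class v) = pres_class (u ++ v).
Proof. by apply/pres_classP/pres_cat; apply: pres_eq_repr. Qed.

Lemma word_invK : involutive word_inv.
Proof.
move=> w; rewrite /word_inv map_rev revK -map_comp map_id_in // => -[i b] _ /=.
by rewrite negbK.
Qed.

Lemma word_inv_cat u v : word_inv (u ++ v) = word_inv v ++ word_inv u.
Proof. by rewrite /word_inv map_cat rev_cat. Qed.

Lemma pres_eq_invr w : pres_eq R (w ++ word_inv w) [::].
Proof.
elim: w => [|[i b] w IHw]; first exact: pres_refl.
have -> : word_inv ((i, b) :: w) = word_inv w ++ [:: (i, ~~ b)].
  by rewrite /word_inv /= rev_cons cats1.
rewrite -cat1s -catA (catA w); apply: pres_trans (pres_cancel R i b).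
by apply: pres_cat (pres_refl R _) _; apply: pres_cat IHw (pres_refl R _).
Qed.

Lemma pres_mulA : associative pres_mul.
Proof.
move=> x y z; rewrite -[x]pres_reprK -[y]pres_reprK -[z]pres_reprK.
by rewrite !pres_mulE catA.
Qed.

Lemma pres_mul1 : left_id pres_one pres_mul.
Proof. by move=> x; rewrite -[x]pres_reprK pres_mulE. Qed.

Lemma pres_mulr1 : right_id pres_one pres_mul.
Proof. by move=> x; rewrite -[x]pres_reprK pres_mulE cats0. Qed.

Lemma pres_mulrV : right_inverse pres_one pres_inv pres_mul.
Proof.
move=> x; rewrite -{1}[x]pres_reprK pres_mulE.
exact/pres_classP/pres_eq_invr.
Qed.

Lemma pres_mulV : left_inverse pres_one pres_inv pres_mul.
Proof.
move=> x; rewrite -{2}[x]pres_reprK pres_mulE; apply/pres_classP.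
by rewrite -{2}[repr x]word_invK; apply: pres_eq_invr.
Qed.

HB.instance Definition _ := isGroup.Build presented
  pres_mulA pres_mul1 pres_mulr1 pres_mulV pres_mulrV.

Lemma pres_classM u v : pres_class (u ++ v) = (pres_class u * pres_class v)%g.
Proof. by rewrite -pres_mulE. Qed.

Lemma pres_genV i : (pres_gen i)^-1%g = pres_class [:: (i, false)].
Proof.
apply: (mulgI (pres_gen i)); rewrite mulgV -pres_classM.
exact/esym/pres_classP/(pres_cancel R i true).
Qed.

Section Universal.
Context (G : groupType) (f : I -> G).

Definition word_eval (w : word I) : G :=
  foldr (fun l g => ((if l.2 then f l.1 else (f l.1)^-1) * g)%g) 1%g w.

Lemma word_eval_cat u v : word_eval (u ++ v) = (word_eval u * word_eval v)%g.
Proof. by elim: u => [|l u IHu] /=; rewrite ?mul1g // IHu mulgA. Qed.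

Lemma pres_hom_exists : (forall u v, R u v -> word_eval u = word_eval v) ->
  exists phi : {multiplicative presented -> G}, forall i, phi (pres_gen i) = f i.
Proof.
move=> fR.
have feq u v : pres_eq R u v -> word_eval u = word_eval v.
  elim=> {u v} // [i [] /=|u v w _ -> _ -> //|u u' v v' _ IHu _ IHv].
  - by rewrite mulg1 mulgV.
  - by rewrite mulg1 mulVg.
  - by rewrite !word_eval_cat IHu IHv.
have phiM : {morph (word_eval \o repr : presented -> G) : x y / (x * y)%g}.
  move=> x y /=; rewrite -word_eval_cat; apply: feq.
  exact: (pres_eq_repr (repr x ++ repr y)).
pose phi := isMultiplicative.Build presented G (word_eval \o repr) phiM.
exists (HB.pack_for {multiplicative presented -> G} (word_eval \o repr) phi).
by move=> i /=; rewrite (feq _ _ (pres_eq_repr _)) /= mulg1.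
Qed.
End Universal.

Lemma presented_ind (P : presented -> Prop) :
  P 1%g -> (forall i x, P x -> P (pres_gen i * x)%g) ->
  (forall i x, P x -> P ((pres_gen i)^-1 * x)%g) -> forall x, P x.
Proof.
move=> P1 Pg PV x; rewrite -[x]pres_reprK.
elim: (repr x) => [//|[i b] w IHw]; rewrite -cat1s pres_classM.
by case: b; [apply: Pg | rewrite -pres_genV; apply: PV].
Qed.

End Presented.

Definition group_ring (G : groupType) : Type := {malg int[G]}.

HB.instance Definition _ (G : groupType) := GRing.Zmodule.on (group_ring G).

HB.lock Definition gr (G : groupType) (g : G) : group_ring G := << 1 *g g >>.
Canonical gr_unlockable := Unlockable gr.unlock.
Arguments gr {G} g%_g.

HB.lock Definition gr_mul (G : groupType) (a b : {malg int[G]}) : {malg int[G]} :=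
  \sum_(g <- msupp a) \sum_(h <- msupp b) << a@_g * b@_h *g (g * h)%g >>.
Canonical gr_mul_unlockable := Unlockable gr_mul.unlock.

(* The Z-linear extension of f : G -> V to the group ring. *)
HB.lock Definition gr_ext (G : groupType) (V : zmodType) (f : G -> V)
    (a : group_ring G) : V :=
  \sum_(g <- msupp a) f g *~ a@_g.
Canonical gr_ext_unlockable := Unlockable gr_ext.unlock.

Section GroupRing.
Context (G : groupType).
Implicit Types (a b : {malg int[G]}) (d : {fset G}).
Local Notation gr_mul := (@gr_mul G).

Lemma gr_mulw d1 d2 a b : (msupp a `<=` d1)%fset -> (msupp b `<=` d2)%fset ->
  gr_mul a b = \sum_(g <- d1) \sum_(h <- d2) << a@_g * b@_h *g (g * h)%g >>.
Proof.
move=> le_d1 le_d2; rewrite unlock (big_fset_incl _ le_d1) /=.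
  apply/eq_bigr=> k1 _; apply/big_fset_incl => // k _ /mcoeff_outdom ->.
  by rewrite mulr0 monalgU0.
move=> k _ /mcoeff_outdom g1k.
by rewrite big1 => // k' _; rewrite g1k mul0r monalgU0.
Qed.

Lemma gr_mulDl : left_distributive gr_mul +%R.
Proof.
move=> a b c; rewrite (gr_mulw (msuppD_le a b) (fsubset_refl _)).
rewrite (gr_mulw (fsubsetUl (msupp a) (msupp b)) (fsubset_refl (msupp c))).
rewrite (gr_mulw (fsubsetUr (msupp a) (msupp b)) (fsubset_refl (msupp c))).
rewrite -big_split /=; apply/eq_bigr=> g _.
rewrite -big_split /=; apply/eq_bigr=> h _.
by rewrite mcoeffD mulrDl monalgUD.
Qed.

Lemma gr_mulDr : right_distributive gr_mul +%R.
Proof.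
move=> c a b; rewrite (gr_mulw (fsubset_refl _) (msuppD_le a b)).
rewrite (gr_mulw (fsubset_refl (msupp c)) (fsubsetUl (msupp a) (msupp b))).
rewrite (gr_mulw (fsubset_refl (msupp c)) (fsubsetUr (msupp a) (msupp b))).
rewrite -big_split /=; apply/eq_bigr=> g _.
rewrite -big_split /=; apply/eq_bigr=> h _.
by rewrite mcoeffD mulrDr monalgUD.
Qed.

Lemma gr_mul0 : left_zero 0 gr_mul.
Proof. by move=> a; rewrite unlock msupp0 big_seq_fset0. Qed.

Lemma gr_mulr0 : right_zero 0 gr_mul.
Proof. by move=> a; rewrite unlock exchange_big msupp0 big_seq_fset0. Qed.

Lemma gr_mulUU c1 c2 g h :
  gr_mul << c1 *g g >> << c2 *g h >> = << c1 * c2 *g (g * h)%g >>.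
Proof. by rewrite (gr_mulw msuppU_le msuppU_le) !big_seq_fset1 !mcoeffUU. Qed.

Lemma malg_indU (P : {malg int[G]} -> Prop) :
  P 0 -> (forall a b, P a -> P b -> P (a + b)) ->
  (forall c g, P << c *g g >>) -> forall a, P a.
Proof. by move=> P0 PD PU a; rewrite [a]monalgE; apply: big_ind. Qed.

Lemma gr_mulA : associative gr_mul.
Proof.
move=> a b c; elim/malg_indU: a => [|a a' IHa IHa'|x g].
- by rewrite !gr_mul0.
- by rewrite !gr_mulDl IHa IHa'.
elim/malg_indU: b => [|b b' IHb IHb'|y h].
- by rewrite !(gr_mul0, gr_mulr0).
- by rewrite !(gr_mulDl, gr_mulDr) IHb IHb'.
elim/malg_indU: c => [|c c' IHc IHc'|z k].
- by rewrite !gr_mulr0.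
- by rewrite !gr_mulDr IHc IHc'.
by rewrite !gr_mulUU mulrA mulgA.
Qed.

Lemma grE (g : G) : gr g = << 1 *g g >>.
Proof. by rewrite unlock. Qed.

Lemma gr_mul1 : left_id (gr (1%g : G)) gr_mul.
Proof.
move=> a; elim/malg_indU: a => [|a b IHa IHb|x g].
- exact: gr_mulr0.
- by rewrite gr_mulDr IHa IHb.
- by rewrite grE gr_mulUU mul1r mul1g.
Qed.

Lemma gr_mulr1 : right_id (gr (1%g : G)) gr_mul.
Proof.
move=> a; elim/malg_indU: a => [|a b IHa IHb|x g].
- exact: gr_mul0.
- by rewrite gr_mulDl IHa IHb.
- by rewrite grE gr_mulUU mulr1 mulg1.
Qed.

Lemma gr_1_neq0 : gr (1%g : G) != 0.
Proof. by rewrite grE monalgU_eq0 oner_eq0. Qed.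

HB.instance Definition _ := GRing.Zmodule_isNzRing.Build (group_ring G)
  gr_mulA gr_mul1 gr_mulr1 gr_mulDl gr_mulDr gr_1_neq0.

Lemma grM g h : gr (g * h)%g = gr g * gr h.
Proof. by rewrite !grE [RHS]gr_mulUU mulr1. Qed.

Lemma gr1 : gr (1%g : G) = 1.
Proof. by []. Qed.

Section Extension.
Context (V : zmodType) (f : G -> V).

Lemma gr_extw d (a : group_ring G) : (msupp a `<=` d)%fset ->
  gr_ext f a = \sum_(g <- d) f g *~ a@_g.
Proof.
move=> le_d; rewrite unlock (big_fset_incl _ le_d) //= => g _ /mcoeff_outdom ->.
by rewrite mulr0z.
Qed.

Lemma gr_ext_is_additive : additive (gr_ext f).
Proof.
move=> a b; rewrite (gr_extw (msuppB_le a b)).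
rewrite (gr_extw (fsubsetUl (msupp a) (msupp b))).
rewrite (gr_extw (fsubsetUr (msupp a) (msupp b))) -sumrB.
by apply: eq_bigr => g _; rewrite mcoeffB mulrzBr.
Qed.

HB.instance Definition _ :=
  GRing.isAdditive.Build (group_ring G) V (gr_ext f) gr_ext_is_additive.

Lemma gr_ext_gr g : gr_ext f (gr g) = f g.
Proof. by rewrite grE (gr_extw msuppU_le) big_seq_fset1 mcoeffUU. Qed.
End Extension.

End GroupRing.

(* The ring map Z[G] -> Z[H] induced by phi : G -> H. *)
Definition gr_map (G H : groupType) (phi : G -> H) :
    group_ring G -> group_ring H :=
  gr_ext (fun g => gr (phi g)).

Record aut (G : groupType) := Aut {
  aut_fun :> G -> G;
  aut_inv : G -> G;
  aut_funM : {morph aut_fun : x y / (x * y)%g};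
  aut_funK : cancel aut_fun aut_inv;
  aut_invK : cancel aut_inv aut_fun
}.

Section Automorphisms.
Context (G : groupType).

HB.instance Definition _ := gen_eqMixin (aut G).
HB.instance Definition _ := gen_choiceMixin (aut G).

Lemma aut_eqP (f g : aut G) : f =1 g -> f = g.
Proof.
case: f g => [f f' fM fK f'K] [g g' gM gK g'K] /= /funext efg.
case: g / efg gM gK g'K => gM gK g'K.
have /funext ef : f' =1 g' by move=> x; rewrite -{1}(g'K x) fK.
case: g' / ef gK g'K => gK g'K.
by congr Aut; apply: Prop_irrelevance.
Qed.

Definition aut_one : aut G :=
  @Aut G id id (fun _ _ => erefl) (fun _ => erefl) (fun _ => erefl).

Lemma aut_compM (f g : aut G) : {morph f \o g : x y / (x * y)%g}.
Proof. by move=> x y; rewrite /= !aut_funM. Qed.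

(* Automorphisms act on the left: (f * g) x = f (g x). *)
Definition aut_mul (f g : aut G) : aut G :=
  Aut (@aut_compM f g) (can_comp (@aut_funK _ f) (@aut_funK _ g))
    (can_comp (@aut_invK _ g) (@aut_invK _ f)).

Lemma aut_invM (f : aut G) : {morph aut_inv f : x y / (x * y)%g}.
Proof.
move=> x y; rewrite -{1}[x](@aut_invK _ f) -{1}[y](@aut_invK _ f).
by rewrite -aut_funM aut_funK.
Qed.

Definition aut_inverse (f : aut G) : aut G :=
  Aut (@aut_invM f) (@aut_invK _ f) (@aut_funK _ f).

Lemma aut_mulA : associative aut_mul.
Proof. by move=> f g h; apply: aut_eqP. Qed.

Lemma aut_mul1 : left_id aut_one aut_mul.
Proof. by move=> f; apply: aut_eqP. Qed.

Lemma aut_mulr1 : right_id aut_one aut_mul.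
Proof. by move=> f; apply: aut_eqP. Qed.

Lemma aut_mulV : left_inverse aut_one aut_inverse aut_mul.
Proof. by move=> f; apply: aut_eqP => x; apply: aut_funK. Qed.

Lemma aut_mulrV : right_inverse aut_one aut_inverse aut_mul.
Proof. by move=> f; apply: aut_eqP => x; apply: aut_invK. Qed.

HB.instance Definition _ := isGroup.Build (aut G)
  aut_mulA aut_mul1 aut_mulr1 aut_mulV aut_mulrV.

HB.instance Definition _ (f : aut G) :=
  isMultiplicative.Build G G (aut_fun f) (@aut_funM G f).

End Automorphisms.

Definition free_group (n : nat) := @presented 'I_n (fun _ _ => False).

HB.instance Definition _ n := Group.on (free_group n).

Definition fgen {n} (k : 'I_n) : free_group n := pres_gen _ k.

(* Indices are shifted down by one: 'I_n.-1 indexes s_1, ..., s_(n-1). *)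
Inductive twin_rel (n : nat) : word 'I_n.-1 -> word 'I_n.-1 -> Prop :=
| twin_invol i : twin_rel [:: (i, true); (i, true)] [::]
| twin_comm (i j : 'I_n.-1) : (2 <= `|i - j|)%N ->
    twin_rel [:: (i, true); (j, true)] [:: (j, true); (i, true)].

Definition twin_group (n : nat) := presented (@twin_rel n).

HB.instance Definition _ n := Group.on (twin_group n).

Definition tgen {n} (i : 'I_n.-1) : twin_group n := pres_gen _ i.

Fact twin_succ_lt n (i : 'I_n.-1) : (i.+1 < n)%N.
Proof. by case: n i => [|n] [i]. Qed.

Fact twin_lt n (i : 'I_n.-1) : (i < n)%N.
Proof. exact: ltnW (twin_succ_lt i). Qed.

(* The positions i and i + 1 attached to the generator s_i. *)
Definition lo {n} (i : 'I_n.-1) : 'I_n := Ordinal (twin_lt i).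
Definition hi {n} (i : 'I_n.-1) : 'I_n := Ordinal (twin_succ_lt i).

Section Fox.
Context {n : nat} (k : 'I_n).

Definition fox_letter (l : 'I_n * bool) : group_ring (free_group n) :=
  if l.1 == k then if l.2 then 1 else - gr (fgen l.1)^-1 else 0.

Fixpoint fox_word (w : word 'I_n) : group_ring (free_group n) :=
  if w is l :: w' then fox_letter l + gr (pres_class _ [:: l]) * fox_word w'
  else 0.

(* The choice of the representing word is immaterial by fox_pres_class below. *)
Definition fox : group_ring (free_group n) -> group_ring (free_group n) :=
  gr_ext (fun u : free_group n => fox_word (repr u)).

HB.instance Definition _ := GRing.Additive.on fox.

Lemma fox_word_cat u v :
  fox_word (u ++ v) = fox_word u + gr (pres_class _ u) * fox_word v.
Proof.
elim: u => [|l u IHu] /=; first by rewrite [gr _]gr1 mul1r add0r.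
have -> : pres_class (fun _ _ => False) (l :: u) =
    (pres_class _ [:: l] * pres_class _ u)%g by rewrite -pres_classM.
by rewrite IHu mulrDr grM mulrA addrA.
Qed.

Lemma fox_word_eq u v :
  pres_eq (fun _ _ => False) u v -> fox_word u = fox_word v.
Proof.
elim=> {u v} // [i b|u v w _ -> _ -> //|u u' v v' equu' IHu _ IHv].
- rewrite /= mulr0 addr0 /fox_letter /=; case: eqP => _; last by rewrite mulr0 addr0.
  case: b => /=; last by rewrite mulr1 pres_genV addrC subrr.
  by rewrite mulrN -[pres_class _ _]/(fgen i) -grM mulgV subrr.
- by rewrite !fox_word_cat IHu IHv (proj2 (pres_classP _ _ _) equu').
Qed.

Lemma fox_pres_class w : fox (gr (pres_class _ w)) = fox_word w.
Proof. by rewrite /fox gr_ext_gr; apply/fox_word_eq/pres_eq_repr. Qed.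

Lemma fox_gen i : fox (gr (fgen i)) = (i == k)%:R.
Proof.
by rewrite fox_pres_class /= mulr0 addr0 /fox_letter /=; case: eqP.
Qed.

Lemma fox_genV i : fox (gr (fgen i)^-1) = - (i == k)%:R * gr (fgen i)^-1.
Proof.
rewrite {1}pres_genV fox_pres_class /= mulr0 addr0 /fox_letter /=.
by case: eqP => _; rewrite ?mulN1r ?oppr0 ?mul0r.
Qed.

Lemma foxM (u v : free_group n) :
  fox (gr (u * v)) = fox (gr u) + gr u * fox (gr v).
Proof.
rewrite -[u]pres_reprK -[v]pres_reprK -pres_classM !fox_pres_class.
exact: fox_word_cat.
Qed.
End Fox.

Definition jacobian {n} (phi : aut (free_group n)) :
    'M[group_ring (free_group n)]_n :=
  \matrix_(l < n, k < n) fox k (gr (phi (fgen l))).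

(* The Magnus sense of "representation": rho is multiplicative up to the action
   of eta on the coefficients, as dictated by the chain rule for Fox derivatives.
   Equivalently, v |-> (eta g)(v) *m rho g defines an action of G on the
   row vectors over Z[F_n]. *)
Definition magnus_representation {n} (G : groupType)
    (eta : {multiplicative G -> aut (free_group n)})
    (rho : G -> 'M[group_ring (free_group n)]_n) : Prop :=
  rho 1%g = 1%:M /\
  forall g h, rho (g * h)%g = map_mx (gr_map (eta g)) (rho h) *m rho g.

Definition mx22 {R : nzRingType} (a b c d : R) : 'M[R]_(1 + 1) :=
  block_mx a%:M b%:M c%:M d%:M.

Fact twin_block_size n (i : 'I_n.-1) : (i + (1 + 1 + (n - i.+2)) = n)%N.
Proof. by rewrite addnA addn2 subnKC // twin_succ_lt. Qed.

(* diag(I, B, I) with B in rows and columns lo i and hi i. *)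
Definition twin_block {R : nzRingType} {n} (i : 'I_n.-1) (B : 'M[R]_(1 + 1)) :
    'M[R]_n :=
  castmx (twin_block_size i, twin_block_size i)
    (block_mx 1%:M 0 0 (block_mx B 0 0 1%:M)).

Definition is_eta1 {n}
    (eta : {multiplicative twin_group n -> aut (free_group n)}) : Prop :=
  forall i : 'I_n.-1, let x := fgen (lo i) in let y := fgen (hi i) in
  [/\ eta (tgen i) x = (x * y * x^-1)%g,
      eta (tgen i) y = (x * y^-1 * x * y * x^-1)%g
    & forall k, k != lo i -> k != hi i -> eta (tgen i) (fgen k) = fgen k].

Section Existence.
Context {n : nat}.
Local Notation F := (free_group n).

Lemma mulf1 (G H : groupType) (f : {multiplicative G -> H}) : f 1%g = 1%g.
Proof. by apply: (mulgI (f 1%g)); rewrite -gmulfM !mulg1. Qed.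

Lemma mulfV (G H : groupType) (f : {multiplicative G -> H}) x :
  f x^-1%g = (f x)^-1%g.
Proof. by apply: (mulgI (f x)); rewrite -gmulfM !mulgV mulf1. Qed.

Lemma aut_funV (G : groupType) (f : aut G) x : f x^-1%g = (f x)^-1%g.
Proof. exact: (mulfV f). Qed.

Lemma fgen_ext (G : groupType) (f g : {multiplicative F -> G}) :
  (forall k, f (fgen k) = g (fgen k)) -> f =1 g.
Proof.
move=> efg; apply: presented_ind => [|k x IHx|k x IHx]; first by rewrite !mulf1.
- by rewrite !gmulfM IHx efg.
- by rewrite !gmulfM IHx !mulfV efg.
Qed.

Definition eta1_gen (i : 'I_n.-1) (k : 'I_n) : F :=
  let x := fgen (lo i) in let y := fgen (hi i) in
  if k == lo i then (x * y * x^-1)%g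
  else if k == hi i then (x * y^-1 * x * y * x^-1)%g else fgen k.

Lemma lo_neq_hi (i : 'I_n.-1) : (hi i == lo i) = false.
Proof. by rewrite -val_eqE /= gtn_eqF. Qed.

Lemma eta1_gen_aut i : exists phi : aut F,
  (forall k, phi (fgen k) = eta1_gen i k) /\ (phi * phi = 1)%g.
Proof.
have [//|phi phiE] := @pres_hom_exists _ (fun _ _ => False) _ (eta1_gen i).
have phi_lo : phi (fgen (lo i)) = (fgen (lo i) * fgen (hi i) * (fgen (lo i))^-1)%g.
  by rewrite phiE /eta1_gen eqxx.
have phi_hi : phi (fgen (hi i)) =
    (fgen (lo i) * (fgen (hi i))^-1 * fgen (lo i) * fgen (hi i)
       * (fgen (lo i))^-1)%g.
  by rewrite phiE /eta1_gen lo_neq_hi eqxx.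
have phiK : cancel phi phi.
  move=> u; apply: (fgen_ext (f := phi \o phi) (g := idfun)) => k /=.
  rewrite [phi (fgen k)]phiE /eta1_gen; case: eqP => [->|/eqP nlo].
    rewrite !(gmulfM, mulfV) phi_lo phi_hi !invgM !invgK !mulgA.
    by rewrite !(mulgVK, mulgK, mulVg, mul1g).
  case: eqP => [->|/eqP nhi].
    rewrite !(gmulfM, mulfV) phi_lo phi_hi !invgM !invgK !mulgA.
    by rewrite !(mulgVK, mulgK, mulVg, mul1g, mulgV).
  by rewrite phiE /eta1_gen (negPf nlo) (negPf nhi).
exists (@Aut F phi phi (@gmulfM _ _ phi) phiK phiK); split; first exact: phiE.
exact: aut_eqP.
Qed.

Lemma eta1_gen_comm (f g : aut F) (i j : 'I_n.-1) : (i.+1 < j)%N ->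
  (forall k, f (fgen k) = eta1_gen i k) ->
  (forall k, g (fgen k) = eta1_gen j k) -> (f * g = g * f)%g.
Proof.
move=> ltij fE gE.
have lj : (j == i :> nat) = false by rewrite gtn_eqF // ltnW.
have lj' : (j == i.+1 :> nat) = false by rewrite gtn_eqF.
have lj1 : (j.+1 == i :> nat) = false by rewrite gtn_eqF // ltnW // ltnW // ltnW.
have lj1' : (j.+1 == i.+1 :> nat) = false by rewrite eqSS.
have glo : g (fgen (lo i)) = fgen (lo i).
  by rewrite gE /eta1_gen -!val_eqE /= ![i == _ :> nat]eq_sym lj lj1.
have ghi : g (fgen (hi i)) = fgen (hi i).
  by rewrite gE /eta1_gen -!val_eqE /= ![i.+1 == _ :> nat]eq_sym lj' lj1'.
have flo : f (fgen (lo j)) = fgen (lo j).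
  by rewrite fE /eta1_gen -!val_eqE /= lj lj'.
have fhi : f (fgen (hi j)) = fgen (hi j).
  by rewrite fE /eta1_gen -!val_eqE /= lj1 lj1'.
apply: aut_eqP; apply: (fgen_ext (f := f \o g) (g := g \o f)) => k /=.
rewrite [g (fgen k)]gE [f (fgen k)]fE /eta1_gen.
case: (eqVneq k (lo i)) => [->|nlo].
  by rewrite -!val_eqE /= ![i == _ :> nat]eq_sym lj lj1 !(aut_funM, aut_funV)
             glo ghi fE /eta1_gen eqxx.
case: (eqVneq k (hi i)) => [->|nhi].
  by rewrite -!val_eqE /= ![i.+1 == _ :> nat]eq_sym lj' lj1' !(aut_funM, aut_funV)
             glo ghi fE /eta1_gen lo_neq_hi eqxx.
case: eqP => [->|/eqP njlo].
  by rewrite !(aut_funM, aut_funV) flo fhi gE /eta1_gen eqxx.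
case: eqP => [->|/eqP njhi].
  by rewrite !(aut_funM, aut_funV) flo fhi gE /eta1_gen lo_neq_hi eqxx.
by rewrite gE fE /eta1_gen !ifN.
Qed.

Lemma eta1_exists :
  exists eta : {multiplicative twin_group n -> aut F}, is_eta1 eta.
Proof.
have [f fE] := choice eta1_gen_aut.
have [|eta etaE] := @pres_hom_exists _ (@twin_rel n) (aut F) f.
  move=> u v [i|i j ij] /=; rewrite !mulg1; first by case: (fE i).
  have [ltij|ltji] : (i.+1 < j)%N \/ (j.+1 < i)%N.
    case: (ltngtP i j) ij => [lt|lt|->]; last by rewrite distnn.
    - by rewrite (distnEr (ltnW lt)) ltn_subRL addn1; left.
    - by rewrite (distnEl (ltnW lt)) ltn_subRL addn1; right.
  - exact: eta1_gen_comm ltij (fE i).1 (fE j).1.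
  - exact/esym/(eta1_gen_comm ltji (fE j).1 (fE i).1).
exists eta => i x y; 
have etai k : eta (tgen i) (fgen k) = eta1_gen i k.
  by rewrite etaE; apply: (fE i).1.
split=> [||k nlo nhi]; rewrite etai /eta1_gen ?eqxx ?lo_neq_hi //.
by rewrite !ifN.
Qed.
End Existence.

(* Main.v *)
From HB Require Import structures.
Require Import Defs.
From mathcomp Require Import all_boot all_algebra.
From mathcomp Require Import monoid.
From mathcomp Require Import monalg zify.

(** The Jacobian is a Magnus representation because of the chain rule of Fox
    calculus, [fox_chain]: an endomorphism phi of the free group satisfies
      D_k (phi u) = sum_m phi (D_m u) * D_k (phi x_m)   for every u.
    As functions of u, both sides satisfy the twisted product rule
    E (u v) = E u + phi u * E v, and they agree on the generators, hence
    everywhere.  For u = psi x_l this reads J (phi psi) = phi (J psi) * J phi,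
    which is the twisted multiplicativity of a Magnus representation.

    The matrix of s_i is a computation with the product rule.  The words
    x y x^-1 and x y^-1 x y x^-1, for x = x_i and y = x_(i+1), involve only these
    two letters, so their rows vanish outside columns i and i+1; every fixed
    generator gives a row of the identity matrix.  [twin_blockE] expresses the
    entries of the block matrix in the same form, as combinations of the
    Kronecker symbols of columns i and i+1. *)

Import GRing.Theory.
Local Open Scope ring_scope.

Lemma malgU_gr (G : groupType) (c : int) (g : G) :
  << c *g g >> = gr g *~ c :> group_ring G.
Proof.
apply/malgP => h; rewrite grE raddfMz /= !mcoeffU.
by case: (g == h); rewrite ?mul0rz // !mulr1n intz.
Qed.

Section GroupRingMap.
Context (G H : groupType) (phi : {multiplicative G -> H}).

HB.instance Definition _ :=
  GRing.Additive.copy (gr_map phi) (gr_ext (fun g => gr (phi g))).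

Lemma gr_map_gr g : gr_map phi (gr g) = gr (phi g).
Proof. exact: gr_ext_gr. Qed.

(** The left factor is a group element because this is the only kind of product
    in the rule D (u v) = D u + u * D v. *)
Lemma gr_mapMl g a : gr_map phi (gr g * a) = gr (phi g) * gr_map phi a.
Proof.
elim/malg_indU: a => [|a b IHa IHb|c h].
- by rewrite mulr0 !raddf0 mulr0.
- by rewrite mulrDr !raddfD /= IHa IHb mulrDr.
by rewrite malgU_gr mulrzAr -grM !raddfMz /= !gr_map_gr gmulfM grM mulrzAr.
Qed.
End GroupRingMap.

Lemma fox1 n (k : 'I_n) : fox k (gr 1) = 0.
Proof. exact: fox_pres_class k [::]. Qed.

Lemma foxV n (k : 'I_n) (u : free_group n) :
  fox k (gr u^-1) = - (gr u^-1 * fox k (gr u)).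
Proof.
apply/eqP; rewrite -addr_eq0 -foxM.
by rewrite mulVg fox1.
Qed.

Section ChainRule.
Context {n : nat} (phi : {multiplicative free_group n -> free_group n}).

(** The right-hand side D obeys the same twisted product rule as the left-hand
    side, and a function obeying it is determined by its values on the
    generators; the value at x_i^-1 is forced by D (x_i^-1 x_i) = 0. *)
Lemma fox_chain (k : 'I_n) (u : free_group n) :
  fox k (gr (phi u)) =
    \sum_m gr_map phi (fox m (gr u)) * fox k (gr (phi (fgen m))).
Proof.
set D := fun u => \sum_m gr_map phi (fox m (gr u)) * fox k (gr (phi (fgen m))).
have DM v w : D (v * w)%g = D v + gr (phi v) * D w.
  rewrite /D mulr_sumr -big_split; apply: eq_bigr => m _ /=.
  by rewrite foxM raddfD /= gr_mapMl mulrDl mulrA.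
have D1 : D 1%g = 0.
  by rewrite /D big1 // => m _; rewrite fox1 raddf0 mul0r.
have Dgen i : D (fgen i) = fox k (gr (phi (fgen i))).
  rewrite /D (bigD1 i) //= big1 ?addr0 => [|m /negPf ne_mi].
    by rewrite fox_gen eqxx -gr1 gr_map_gr mulf1 gr1 mul1r.
  by rewrite fox_gen eq_sym ne_mi raddf0 mul0r.
have DV i : D (fgen i)^-1%g = fox k (gr (phi (fgen i)^-1%g)).
  rewrite Defs.mulfV foxV -Dgen; apply/eqP; rewrite -addr_eq0.
  by rewrite -Defs.mulfV -DM mulVg D1.
rewrite -[RHS]/(D u); move: u; apply: presented_ind => [|i u IHu|i u IHu].
- by rewrite mulf1 fox1 D1.
- by rewrite gmulfM foxM IHu DM Dgen.
- by rewrite gmulfM foxM IHu DM DV.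
Qed.
End ChainRule.

Lemma jacobian1 n : jacobian (1%g : aut (free_group n)) = 1%:M.
Proof. by apply/matrixP => l k; rewrite !mxE /= fox_gen. Qed.

(** The entrywise chain rule: the coefficients of [jacobian g] get transported
    by f because f is the outer map of the composite. *)
Lemma jacobianM n (f g : aut (free_group n)) :
  jacobian (f * g)%g = map_mx (gr_map f) (jacobian g) *m jacobian f.
Proof.
apply/matrixP => l k; rewrite !mxE /= fox_chain.
by apply: eq_bigr => m _; rewrite !mxE.
Qed.

Lemma jacobian_magnus n (G : groupType)
    (eta : {multiplicative G -> aut (free_group n)}) :
  magnus_representation eta (fun g => jacobian (eta g)).
Proof.
by split=> [|g h]; rewrite ?mulf1 ?jacobian1 // gmulfM jacobianM.
Qed.

(** The two middle rows are written with Kronecker symbols of the column because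
    this is the form in which the product rule delivers D_k of a word. *)
Lemma twin_blockE (R : nzRingType) n (i : 'I_n.-1) (a b c d : R) (l k : 'I_n) :
  twin_block i (mx22 a b c d) l k =
    if l == lo i then a * (lo i == k)%:R + b * (hi i == k)%:R
    else if l == hi i then c * (lo i == k)%:R + d * (hi i == k)%:R
    else (l == k)%:R.
Proof.
have valE (p q : 'I_n) : (p == q) = (p == q :> nat) by [].
rewrite /twin_block castmxE /mx22 /block_mx !valE /=.
(* Three nested block decompositions for the row index, three for the column;
   each of the resulting entries is then settled by comparing positions. *)
do 3 (rewrite ?mxE; try case: splitP => /= ? ?).
all: do 3 (rewrite ?mxE; try case: splitP => /= ? ?).
all: rewrite ?mxE -?val_eqE /=.
all: repeat (case: eqP => /= ?);
  rewrite ?(mulr0, mulr1, add0r, addr0, mulr0n, mulr1n) //.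
(* What remains are the inconsistent combinations of positions. *)
all: exfalso; repeat match goal with x : 'I_ _ |- _ => destruct x; simpl in * end.
all: lia.
Qed.

Theorem proposition4 (n : nat) (n_ge2 : (2 <= n)%N)
    (eta1 : {multiplicative twin_group n -> aut (free_group n)})
    (eta1P : is_eta1 eta1) :
  magnus_representation eta1 (fun g => jacobian (eta1 g)) /\
  forall i : 'I_n.-1,
    let x := fgen (lo i) in let y := fgen (hi i) in
    jacobian (eta1 (tgen i)) =
      twin_block i
        (mx22 (1 - gr (x * y * x^-1)) (gr x)
              (1 + gr (x * y^-1) - gr (x * y^-1 * x * y * x^-1))
              (- gr (x * y^-1) + gr (x * y^-1 * x))).
Proof.
split=> [|i x y]; first exact: jacobian_magnus.
have [eta_x eta_y eta_fix] := eta1P i.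
apply/matrixP => l k; rewrite twin_blockE mxE.
case: (eqVneq l (lo i)) => [->|nlo].
  rewrite eta_x !foxM foxV !fox_gen -/x -/y mulrN mulrA -grM.
  by rewrite mulrBl mul1r addrAC.
case: (eqVneq l (hi i)) => [->|nhi].
  rewrite eta_y !foxM !foxV !fox_gen -/x -/y !mulrN !mulrA -!grM.
  rewrite mulrBl !mulrDl mul1r mulNr.
  rewrite -!addrA; congr (_ + _); rewrite addrCA; congr (_ + _).
  by rewrite [RHS]addrC -addrA.
by rewrite eta_fix // fox_gen.
Qed.
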